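(* Let $\mathcal{A}$ be an essential central arrangement of $d$ hyperplanes of rank $n$ in $\mathbb{C}^n$, let $I$ be its Orlik-Terao ideal and let $I_2$ be the ideal generated by the quadratic elements of $I$. Then $\mathcal{A}$ is 2-formal if and only if $X = V(I_2)\cap (\mathbb{C}^* )^{d-1}$ has codimension $d-n$ in $\mathbb{P}^{d-1}$.
   Context: Arrangement: $\mathcal{A}=\{H_1,\dots,H_d\}$ is a set of $d$ distinct hyperplanes through the origin in $\mathbb{C}^n$, $H_i=V(\alpha_i)$ with $\alpha_i\in\mathbb{C}[x_1,\dots,x_n]_1$ nonzero linear forms (fixed once and for all; pairwise non-proportional). $\mathcal{A}$ is essential, i.e. $\bigcap_i H_i=\{0\}$, equivalently $\alpha_1,\dots,\alpha_d$ span an $n$-dimensional space (rank $n$). Orlik-Terao ideal: let $R=\mathbb{C}[y_1,\dots,y_d]$. For each $\Lambda=\{i_1,\dots,i_k\}\subseteq\{1,\dots,d\}$ with $\operatorname{codim}\bigcap_{j}H_{i_j}<k$ and each nontrivial linear dependency $\sum_{j=1}^k c_{i_j}\alpha_{i_j}=0$, put $r_\Lambda=\sum_{j}c_{i_j}y_{i_j}$ and $f_\Lambda=\partial(r_\Lambda)=\sum_{j=1}^k c_{i_j}\,(y_{i_1}\cdots\widehat{y_{i_j}}\cdots y_{i_k})$. The ideal $I\subseteq R$ generated by all the $f_\Lambda$ is the Orlik-Terao ideal of $\mathcal{A}$. $I_2$ denotes the ideal of $R$ generated by the degree-two elements of $I$. 2-formality: the relation space $F(\mathcal{A})$ is the kernel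 of the linear map $\bigoplus_{i=1}^d\mathbb{C}e_i\to\mathbb{C}[x_1,\dots,x_n]_1$, $e_i\mapsto\alpha_i$. $\mathcal{A}$ is 2-formal if $F(\mathcal{A})$ is spanned by relations involving only three hyperplanes (three nonzero coefficients). $V(I_2)\subseteq\mathbb{P}^{d-1}$ is the projective vanishing locus, and $(\mathbb{C}^* )^{d-1}\subseteq\mathbb{P}^{d-1}$ is the torus of points all of whose homogeneous coordinates are nonzero. *)

(* Defs.v *)
From HB Require Import structures.
From mathcomp Require Import all_boot all_order all_algebra.
From mathcomp Require Import complex.
From mathcomp Require Import classical_sets reals.
From mathcomp Require Import mpoly.

Set Implicit Arguments.
Unset Strict Implicit.
Unset Printing Implicit Defensive.

Import GRing.Theory.
Local Open Scope ring_scope.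
Local Open Scope classical_set_scope.

(* Everything is defined over an arbitrary field K; the theorem takes K = R[i]
   with R : realType, i.e. the complex numbers. *)

(* A point of affine m-space is a row vector v : 'rV[K]_m; a polynomial f is
   evaluated at v by f.@[v 0], where v 0 : 'I_m -> K lists the coordinates. *)

Definition hyperplane (K : fieldType) (n : nat) (f : {mpoly K[n]}) :
    set 'rV[K]_n :=
  [set v | f.@[v 0] = 0].

(* The indexed family alpha carries the fixed choice of defining forms. *)
Record is_arrangement (K : fieldType) (n d : nat)
    (alpha : 'I_d -> {mpoly K[n]}) : Prop := IsArrangement {
  arr_linear : forall i, alpha i \is 1.-homog;
  arr_neq0 : forall i, alpha i != 0;
  arr_distinct : forall i j,
    hyperplane (alpha i) = hyperplane (alpha j) -> i = j
}.

Definition essential (K : fieldType) (n d : nat)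
    (alpha : 'I_d -> {mpoly K[n]}) : Prop :=
  \bigcap_i hyperplane (alpha i) = [set 0].

Definition ideal_generated (A : comNzRingType) (S : set A) : set A :=
  [set f | exists (m : nat) (a g : 'I_m -> A),
     (forall j, S (g j)) /\ f = \sum_j a j * g j].

Definition OT_generator (K : fieldType) (d : nat)
    (Lam : {set 'I_d}) (c : 'rV[K]_d) : {mpoly K[d]} :=
  \sum_(i in Lam) c 0 i *: \prod_(j in Lam :\ i) 'X_j.

(* The condition codim (\bigcap_(i in Lam) H_i) < #|Lam| need not be listed: it
   says that the forms alpha i, i in Lam, are linearly dependent, so it holds as
   soon as there is a nontrivial dependency c.  The entries of c outside Lam are
   irrelevant.  As in the usual definition, c may vanish at some i in Lam. *)
Definition Orlik_Terao (K : fieldType) (n d : nat)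
    (alpha : 'I_d -> {mpoly K[n]}) : set {mpoly K[d]} :=
  ideal_generated [set f | exists (Lam : {set 'I_d}) (c : 'rV[K]_d),
    [/\ (exists2 i, i \in Lam & c 0 i != 0),
        \sum_(i in Lam) c 0 i *: alpha i = 0
      & f = OT_generator Lam c]].

Definition quadratic_part (K : fieldType) (d : nat) (I : set {mpoly K[d]}) :
    set {mpoly K[d]} :=
  ideal_generated [set f | I f /\ f \is 2.-homog].

(* The elements of the relation space F(A). *)
Definition is_relation (K : fieldType) (n d : nat)
    (alpha : 'I_d -> {mpoly K[n]}) (c : 'rV[K]_d) : Prop :=
  \sum_i c 0 i *: alpha i = 0.

Definition two_formal (K : fieldType) (n d : nat)
    (alpha : 'I_d -> {mpoly K[n]}) : Prop :=
  forall c : 'rV[K]_d, is_relation alpha c ->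
    exists2 s : seq 'rV[K]_d,
      (forall r, r \in s ->
         is_relation alpha r /\ #|[set i | r 0 i != 0]%SET| = 3%N)
      & c \in <<s>>%VS.

(* Points of P^(d-1) are the lines through the origin of K^d. *)
Definition projective (K : fieldType) (d : nat) : Type :=
  {L : {vspace 'rV[K]_d} | \dim L == 1%N}.

Definition proj_line (K : fieldType) (d : nat) (p : projective K d) :
    {vspace 'rV[K]_d} :=
  sval p.

(* The homogeneous coordinate vectors of p are the nonzero elements of
   proj_line p. *)
Definition proj_zeros (K : fieldType) (d : nat) (J : set {mpoly K[d]}) :
    set (projective K d) :=
  [set p | forall (k : nat) (f : {mpoly K[d]}), J f -> f \is k.-homog ->
     forall v, v \in proj_line p -> v != 0 -> f.@[v 0] = 0].

Definition proj_torus (K : fieldType) (d : nat) : set (projective K d) :=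
  [set p | forall v, v \in proj_line p -> v != 0 -> forall i, v 0 i != 0].

(* Zariski topology on P^(d-1) and on its subsets. *)

Definition zariski_closed (K : fieldType) (d : nat) (Y : set (projective K d)) :
    Prop :=
  exists J : set {mpoly K[d]}, Y = proj_zeros J.

Definition zariski_closed_in (K : fieldType) (d : nat)
    (X Y : set (projective K d)) : Prop :=
  exists2 Z, zariski_closed Z & Y = X `&` Z.

Definition irreducible_set (K : fieldType) (d : nat)
    (Y : set (projective K d)) : Prop :=
  Y !=set0 /\
  forall A B, zariski_closed A -> zariski_closed B ->
    Y `<=` A `|` B -> Y `<=` A \/ Y `<=` B.

(* A strictly increasing chain Z 0 < ... < Z (m-1) of m irreducible closed
   subsets of X; its length, in the sense of Krull dimension, is m - 1. *)
Definition irreducible_chain (K : fieldType) (d : nat)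
    (X : set (projective K d)) (m : nat) (Z : nat -> set (projective K d)) :
    Prop :=
  (forall i, (i < m)%N -> zariski_closed_in X (Z i) /\ irreducible_set (Z i)) /\
  (forall i, (i.+1 < m)%N -> Z i `<` Z i.+1).

(* X has Krull dimension k; the empty set has dimension -1. *)
Definition has_dim (K : fieldType) (d : nat) (X : set (projective K d))
    (k : int) : Prop :=
  exists m : nat,
    [/\ k = m%:Z - 1,
        (exists Z, irreducible_chain X m Z)
      & (forall m' Z, irreducible_chain X m' Z -> (m' <= m)%N)].

(* codim X = dim P^(d-1) - dim X. *)
Definition has_codim (K : fieldType) (d : nat) (X : set (projective K d))
    (c : int) : Prop :=
  exists a b : int,
    [/\ has_dim (@setT (projective K d)) a, has_dim X b & c = a - b].

(* Main.v *)
Require Import Defs.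
From HB Require Import structures.
From mathcomp Require Import all_boot all_order all_algebra.
From mathcomp Require Import complex.
From mathcomp Require Import boolp classical_sets reals.
From mathcomp Require Import mpoly.
From mathcomp Require Import zify.
Set Implicit Arguments.
Unset Strict Implicit.
Unset Printing Implicit Defensive.
Import Order.TTheory GRing.Theory Num.Theory.
Local Open Scope ring_scope.
Local Open Scope classical_set_scope.

(** On the torus the quadrics of the Orlik-Terao ideal are linear equations in
    disguise.  Distinct hyperplanes have no dependency with one or two terms, so
    the part of degree two of the ideal is spanned by the generators attached to
    the three-term relations, and at a point v without zero coordinate such a
    generator takes the value (\prod_i v_i) * \sum_i c_i / v_i, both over the
    support of c.  Coordinatewise inversion therefore identifies the set X of
    the theorem with the points without zero coordinate of a linear subspace W:
    the orthogonal of the span of the three-term relations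
    ([quadratic_zeros_in_torus]).

    That span has dimension d - dim W and lies in the relation space, which has
    dimension d - n because the arrangement is essential.  Hence 2-formality
    means dim W = n.  On the other side X has dimension dim W - 1
    ([has_dim_reciprocal_points]), so its codimension is d - dim W, and the two
    conditions coincide.  The subspace W does contain vectors without zero
    coordinate: it contains (alpha_1(u), ..., alpha_d(u)) for all u, and a
    general point u of the moment curve lies on no hyperplane.

    What remains is to compute Krull dimensions from chains of irreducible
    closed sets, for X and for the projective space itself.

    - Lower bound.  A flag of subspaces of W through a vector without zero
      coordinate inverts to a chain.  Its members are irreducible because any
      two points of one are joined by a rational curve that stays inside for
      almost all parameters, and on which a product of two nonzero polynomials
      is nonzero ([irreducible_of_curves]).

    - Upper bound ([chain_length_le]).  Let Z_0 < ... < Z_k be a chain, and for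
      each j > 0 let g_j be a form that vanishes on Z_(j-1) but not on Z_j; let
      g_0 be a coordinate that does not vanish on Z_0.  Since Z_j is
      irreducible, g_j is a nonzerodivisor modulo the polynomials
      vanishing on Z_j; so if a family is linearly independent on Z_(j-1), its
      products with the powers of g_j are independent on Z_j.  Thus the N^(k+1)
      monomials in the g_j with exponents below N are independent on Z_k.  If
      the set is parametrized by polynomials in w variables, these monomials
      pull back to a space of dimension O(N^w), which forces k + 1 <= w. *)

(** * Restriction of polynomials to curves and lines *)

Notation along := (mmap (@polyC _)).

Lemma horner_along (K : fieldType) d (g : 'I_d -> {poly K}) f t :
  (along g f).[t] = f.@[fun i => (g i).[t]].
Proof.
rewrite /mmap /meval /mmap horner_sum; apply: eq_bigr => m _.
rewrite hornerM hornerC /mmap1 horner_prod; congr (_ * _).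
by apply: eq_bigr => i _; rewrite horner_exp.
Qed.

Definition ray (K : fieldType) d (v : 'rV[K]_d) (i : 'I_d) : {poly K} :=
  v 0 i *: 'X.

(** Restricting to the line through v turns products of polynomials into
    products of univariate polynomials, graded by degree: this is how
    homogeneous components are read off below. *)
Lemma along_ray_homog (K : fieldType) d (v : 'rV[K]_d) k f :
  f \is k.-homog -> along (ray v) f = f.@[v 0] *: 'X^k.
Proof.
move=> /dhomogP fk; rewrite /meval /mmap scaler_suml.
apply: eq_big_seq => m /fk mk; rewrite mul_polyC -scalerA; congr (_ *: _).
rewrite /mmap1 /ray (eq_bigr (fun i => (v 0 i ^+ m i) *: 'X^(m i))); last first.
  by move=> i _; rewrite exprZn.
by rewrite scaler_prod prodrXr -mdegE mk.
Qed.

Lemma horner_ray (K : fieldType) d (v : 'rV[K]_d) f c :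
  (along (ray v) f).[c] = f.@[(c *: v) 0].
Proof.
rewrite horner_along; apply: meval_eq => i.
by rewrite /ray !hornerE mxE mulrC.
Qed.

Lemma mevalZ_homog (K : fieldType) d (v : 'rV[K]_d) k f c :
  f \is k.-homog -> f.@[(c *: v) 0] = c ^+ k * f.@[v 0].
Proof.
by move=> /along_ray_homog fk; rewrite -horner_ray fk !hornerE mulrC.
Qed.

Lemma coef_along_ray (K : fieldType) d (v : 'rV[K]_d) f k :
  (along (ray v) f)`_k = (pihomog mdeg k f).@[v 0].
Proof.
pose N := maxn (msize f) k.+1.
have fN : (msize f <= N)%N by apply: leq_maxl.
rewrite {1}(pihomog_partitionE fN) raddf_sum coef_sum.
have kN : (k < N)%N by apply: leq_maxr.
rewrite (bigD1 (Ordinal kN)) //= big1 ?addr0.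
  by rewrite (along_ray_homog v (pihomogP _ _ _)) coefZ coefXn eqxx mulr1.
move=> j; rewrite -val_eqE /= => jk.
rewrite (along_ray_homog v (pihomogP _ _ _)) coefZ coefXn.
by rewrite eq_sym (negbTE jk) mulr0.
Qed.

Lemma exists_nonroot (K : numDomainType) (p : {poly K}) :
  p != 0 -> exists2 t, t != 0 & p.[t] != 0.
Proof.
move=> p0; pose s := [seq (i.+1%:R : K) | i <- iota 0 (size p)].
have su : uniq s.
  by rewrite map_inj_uniq ?iota_uniq // => i j /(mulrIn (oner_neq0 _)) [].
have : ~~ all (root p) s.
  apply/negP => ps; have := max_poly_roots p0 ps su.
  by rewrite size_map size_iota ltnn.
case/allPn => t /mapP[i _ ->] ti; exists i.+1%:R => //.
by rewrite pnatr_eq0.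
Qed.

Lemma poly_eq0_horner (K : numDomainType) (p : {poly K}) :
  (forall t, t != 0 -> p.[t] = 0) -> p = 0.
Proof.
by move=> p0; apply/eqP/negP => /negP /exists_nonroot[t /p0 ->]; rewrite eqxx.
Qed.

(** * Representatives of projective points *)

Lemma proj_line_rep (K : fieldType) d (p : projective K d) :
  exists2 v : 'rV[K]_d, v != 0 & proj_line p = <[v]>%VS.
Proof.
case: p => L /= Ld; exists (vpick L).
  by rewrite vpick0 -dimv_eq0 (eqP Ld).
apply/eqP; rewrite eq_sym eqEdim -memvE memv_pick dim_vline (eqP Ld).
by rewrite vpick0 -dimv_eq0 (eqP Ld).
Qed.

Lemma proj_line_scale (K : fieldType) d (p : projective K d) v w :
  v \in proj_line p -> v != 0 -> w \in proj_line p -> w != 0 ->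
  exists2 c, c != 0 & w = c *: v.
Proof.
have [u _ ->] := proj_line_rep p.
case/vlineP => a ->{v} au /vlineP[b ->{w}] bu.
have a0 : a != 0 by apply: contraNneq au => ->; rewrite scale0r.
have b0 : b != 0 by apply: contraNneq bu => ->; rewrite scale0r.
exists (b / a); first by rewrite mulf_neq0 ?invr_eq0.
by rewrite scalerA divfK.
Qed.

Definition point_of (K : fieldType) d (v : 'rV[K]_d) (v0 : v != 0) :
  projective K d := exist (fun L => \dim L == 1%N) <[v]>%VS
    (introT eqP (etrans (dim_vline v) (congr1 nat_of_bool v0))).

Lemma mem_point_of (K : fieldType) d (v : 'rV[K]_d) (v0 : v != 0) :
  v \in proj_line (point_of v0).
Proof. exact: memv_line. Qed.

Lemma homog_zero_rep (K : fieldType) d (p : projective K d) v w k f :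
  f \is k.-homog -> v \in proj_line p -> v != 0 -> f.@[v 0] = 0 ->
  w \in proj_line p -> w != 0 -> f.@[w 0] = 0.
Proof.
move=> fk vp v0 fv wp w0; have [c _ ->] := proj_line_scale vp v0 wp w0.
by rewrite (mevalZ_homog _ _ fk) fv mulr0.
Qed.

(** * Upper bound for the length of chains *)

Definition vanishes_on (K : fieldType) d (Z : set (projective K d))
    (f : {mpoly K[d]}) : Prop :=
  forall p, Z p -> forall v, v \in proj_line p -> v != 0 -> f.@[v 0] = 0.

(** Irreducibility is tested on homogeneous polynomials only, but P is
    arbitrary here: along each line of Z the product g * P is g(v) X^k times
    the restriction of P, so every homogeneous component of P is reached
    separately. *)
Lemma vanishes_on_prime (K : numFieldType) d (Z : set (projective K d))
    (g P : {mpoly K[d]}) k :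
  irreducible_set Z -> g \is k.-homog -> ~ vanishes_on Z g ->
  vanishes_on Z (g * P) -> vanishes_on Z P.
Proof.
move=> [_ Zirr] gk gZ gPZ.
have comp j : vanishes_on Z (pihomog mdeg j P).
  set Pj := pihomog mdeg j P.
  have Pjj : Pj \is j.-homog by apply: pihomogP.
  have hyp (f : {mpoly K[d]}) (Y : set (projective K d)) :
      Y `<=` proj_zeros [set f] -> forall l, f \is l.-homog -> vanishes_on Y f.
    by move=> Yf l fl p /Yf/(_ l f (erefl _) fl).
  have : Z `<=` proj_zeros [set g] `|` proj_zeros [set Pj].
    move=> p Zp; have [v v0 pv] := proj_line_rep p.
    have vp : v \in proj_line p by rewrite pv memv_line.
    suff : g.@[v 0] * Pj.@[v 0] = 0.
      move/eqP; rewrite mulf_eq0 => /orP[]/eqP fv; [left|right] => l f /= ->.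
        by move=> _; move=> w; apply: (homog_zero_rep gk vp v0 fv).
      by move=> _; move=> w; apply: (homog_zero_rep Pjj vp v0 fv).
    have : along (ray v) (g * P) = 0.
      apply: poly_eq0_horner => c c0; rewrite horner_ray; apply: gPZ Zp _ _ _.
        by rewrite memvZ.
      by rewrite scaler_eq0 negb_or c0.
    rewrite rmorphM /= (along_ray_homog v gk) -scalerAl.
    move/(congr1 (fun q : {poly K} => q`_(k + j))).
    by rewrite coefZ coefXnM ltnNge leq_addr /= addKn coef_along_ray coef0.
  case/Zirr; first by exists [set g].
  - by exists [set Pj].
  - by move=> /hyp/(_ _ gk)/gZ.
  by move=> /hyp/(_ _ Pjj).
move=> p Zp v vp v0; rewrite (pihomog_partitionE (leqnn (msize P))) raddf_sum.
by apply: big1 => j _; apply: comp Zp _ vp v0.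
Qed.

(** There are M ^ w monomials with all exponents below M, and they span a space
    containing all polynomials of size at most M. *)
Lemma linear_dependency (K : fieldType) w (I : finType)
    (t : I -> {mpoly K[w]}) M :
  (forall i, msize (t i) <= M)%N -> (M ^ w < #|I|)%N ->
  exists2 c : I -> K, exists i, c i != 0 & \sum_i c i *: t i = 0.
Proof.
move=> tM card; pose J := {ffun 'I_w -> 'I_M}.
pose mon (f : J) : 'X_{1..w} := [multinom (f i : nat) | i < w].
pose A : 'M[K]_(#|I|, #|{: J}|) :=
  \matrix_(e, f) (t (enum_val e))@_(mon (enum_val f)).
(* Row e of A lists the coefficients of the e-th polynomial on these monomials. *)
have : kermx A != 0.
  rewrite -mxrank_eq0 mxrank_ker -lt0n subn_gt0.
  apply: leq_ltn_trans (rank_leq_col A) _.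
  by rewrite card_ffun !card_ord.
case/rowV0Pn => u /sub_kermxP uA u0.
exists (fun i => u 0 (enum_rank i)).
  have /rV0Pn[e ue] := u0.
  by exists (enum_val e); rewrite enum_valK.
apply/mpolyP => m; rewrite mcoeff0 raddf_sum /=.
have [/forallP mM|/forallP/existsNP[i /negP]] := boolP [forall i, (m i < M)%N].
  pose f : J := [ffun i => Ordinal (mM i)].
  have fm : mon f = m by apply/mnmP => i; rewrite mnmE ffunE.
  have := congr1 (fun B : 'M_(_, _) => B 0 (enum_rank f)) uA.
  rewrite !mxE => uAf; rewrite -[RHS]uAf.
  rewrite (reindex (@enum_val I I)) /=; last exact/onW_bij/enum_val_bij.
  apply: eq_bigr => e _.
  by rewrite mcoeffZ enum_valK mxE enum_rankK fm.
rewrite -leqNgt => Mi.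
apply: big1 => e _; rewrite mcoeffZ memN_msupp_eq0 ?mulr0 //.
apply/negP => /msize_mdeg_lt; rewrite ltnNge => /negP; apply.
apply: leq_trans (tM e) (leq_trans Mi _).
by rewrite mdegE (bigD1 i) //= leq_addr.
Qed.

Definition independent_on (K : fieldType) d (Z : set (projective K d))
    (I : finType) (s : I -> {mpoly K[d]}) : Prop :=
  forall c : I -> K, vanishes_on Z (\sum_i c i *: s i) -> forall i, c i = 0.

(** A combination of the products is a polynomial in g whose coefficients are
    combinations of s. Its constant coefficient is zero by the last hypothesis;
    the rest is divisible by g, which cancels by irreducibility, and one starts
    again. The hypothesis holds when s is independent on a set where g
    vanishes. *)
Lemma independent_powers (K : numFieldType) d (Z : set (projective K d))
    (I : finType) (s : I -> {mpoly K[d]}) (g : {mpoly K[d]}) k N :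
  irreducible_set Z -> g \is k.-homog -> ~ vanishes_on Z g ->
  (forall (c : I -> K) q,
     vanishes_on Z (\sum_i c i *: s i + g * q) -> forall i, c i = 0) ->
  independent_on Z (fun ij : I * 'I_N => s ij.1 * g ^+ ij.2).
Proof.
move=> Zirr gk gZ indep c.
have -> : \sum_ij c ij *: (s ij.1 * g ^+ ij.2) =
    \sum_(j < N) (\sum_i c (i, j) *: s i) * g ^+ j.
  transitivity (\sum_i \sum_(j < N) c (i, j) *: (s i * g ^+ j)).
    by rewrite pair_bigA; apply: eq_bigr => -[i j].
  rewrite exchange_big /=; apply: eq_bigr => j _.
  by rewrite mulr_suml; apply: eq_bigr => i _; rewrite scalerAl.
move=> cZ [i j]; pose c' i j := c (i, j); rewrite -[LHS]/(c' i j).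
have {cZ} : vanishes_on Z (\sum_(j < N) (\sum_i c' i j *: s i) * g ^+ j) := cZ.
elim: N {c} c' j => [|N IH] c j; first by case: j.
rewrite big_ord_recl expr0 mulr1 => cZ.
have tailE : \sum_(i < N) (\sum_i0 c i0 (lift ord0 i) *: s i0) * g ^+ lift ord0 i
    = g * \sum_(i < N) (\sum_i0 c i0 (lift ord0 i) *: s i0) * g ^+ i.
  rewrite mulr_sumr; apply: eq_bigr => l _.
  by rewrite exprS mulrCA.
rewrite tailE in cZ; have c0 := indep _ _ cZ.
case: (unliftP ord0 j) => [l ->|-> //].
apply: (IH (fun i l => c i (lift ord0 l))).
apply: (vanishes_on_prime Zirr gk gZ).
by move: cZ; rewrite big1 ?add0r // => i' _; rewrite c0 scale0r.
Qed.

Lemma msizeM_pred (K : idomainType) w (p q : {mpoly K[w]}) :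
  (msize (p * q) <= (msize p + msize q).-1)%N.
Proof.
have [->|p0] := eqVneq p 0; first by rewrite mul0r msize0.
have [->|q0] := eqVneq q 0; first by rewrite mulr0 msize0.
by rewrite msizeM.
Qed.

Lemma msizeX_le (K : idomainType) w (q : {mpoly K[w]}) j :
  (msize (q ^+ j) <= (j * msize q).+1)%N.
Proof.
elim: j => [|j IH]; first by rewrite expr0 msize1.
rewrite exprS; apply: leq_trans (msizeM_pred _ _) _.
by apply: leq_trans (leq_pred _) _; rewrite mulSn -addnS leq_add2l.
Qed.

(** The monomials in forms g_0, ..., g_k separating the successive members of
    the chain; the constant D, which is independent of N, controls their degree
    after substitution of h. *)
Lemma chain_family (K : numFieldType) d w (h : d.-tuple {mpoly K[w]})
    (X : set (projective K d)) m (Z : nat -> set (projective K d)) k :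
  irreducible_chain X m Z -> (k < m)%N ->
  exists D, forall N, exists (I : finType) (s : I -> {mpoly K[d]}),
    [/\ #|I| = (N ^ k.+1)%N, independent_on (Z k) s
      & forall i, (msize (s i \mPo h) <= (D * N).+1)%N].
Proof.
move=> [Zm Zlt]; elim: k => [|k IH] km.
  have [_ Zirr] := Zm _ km; have [[p Zp] _] := Zirr.
  have [v v0 pv] := proj_line_rep p; have /rV0Pn[i vi] := v0.
  (* Below Z 0 the chain is completed by the origin of the affine cone, where a
     coordinate vanishes and only the constants are independent. *)
  pose g : {mpoly K[d]} := 'X_i.
  have g1 : g \is 1.-homog by rewrite dhomogX /= mdeg1.
  have gZ : ~ vanishes_on (Z 0) g.
    move=> /(_ p Zp v); rewrite pv memv_line mevalXU => /(_ isT v0) vi0.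
    by rewrite vi0 eqxx in vi.
  exists (msize (g \mPo h)) => N.
  exists (unit * 'I_N)%type, (fun ij : unit * 'I_N => 1 * g ^+ ij.2); split.
  - by rewrite card_prod card_unit card_ord mul1n expn1.
  - apply: (independent_powers (s := fun=> 1) Zirr g1 gZ) => c q cZ [].
    have : along (ray v) (\sum_i c i *: 1 + g * q) = 0.
      apply: poly_eq0_horner => a a0; rewrite horner_ray; apply: (cZ _ Zp).
        by rewrite pv memvZ ?memv_line.
      by rewrite scaler_eq0 negb_or a0.
    rewrite rmorphD rmorphM /= (along_ray_homog v g1).
    rewrite (bigD1 tt) //= big1 ?addr0; last by case.
    rewrite mmapZ rmorph1 mulr1 => /(congr1 (fun q : {poly K} => q`_0)).
    by rewrite coefD coefC -scalerAl coefZ coefXnM /= mulr0 addr0 coef0.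
  - move=> [_ j] /=; rewrite mul1r rmorphXn /=.
    apply: leq_trans (msizeX_le _ _) _; rewrite ltnS mulnC leq_mul2l.
    by rewrite (ltnW (ltn_ord j)) orbT.
have [D IHD] := IH (ltnW km).
have [[Y [J YJ] ZkY] _] := Zm _ (ltnW km); have [[Y' _ ZkY'] Zirr] := Zm _ km.
have [sub /existsNP[p /not_implyP[Zp nZp]]] := Zlt _ km.
have : ~ Y p.
  by move=> Yp; apply: nZp; rewrite ZkY; split=> //; move: Zp; rewrite ZkY' => -[].
rewrite YJ /proj_zeros /= => /existsNP[e /existsNP[g]].
move=> /not_implyP[Jg /not_implyP[ge /existsNP[v /not_implyP[vp]]]].
move=> /not_implyP[v0 gv].
have gZ : ~ vanishes_on (Z k.+1) g by move=> /(_ p Zp v vp v0).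
have gZk : vanishes_on (Z k) g.
  move=> q; rewrite ZkY YJ => -[_ /(_ e g Jg ge)]; exact.
exists (D + msize (g \mPo h))%N => N.
have [I [s [cardI indep sD]]] := IHD N.
exists (I * 'I_N)%type, (fun ij : I * 'I_N => s ij.1 * g ^+ ij.2); split.
- by rewrite card_prod cardI card_ord [RHS]expnSr.
- apply: (independent_powers Zirr ge gZ) => c q cZ; apply: indep.
  move=> r Zr u ur u0; have := cZ _ (sub _ Zr) _ ur u0.
  by rewrite mevalD mevalM (gZk _ Zr _ ur u0) mul0r addr0.
- move=> [i j] /=; rewrite rmorphM rmorphXn /=.
  apply: leq_trans (msizeM_pred _ _) _.
  have jN : (j * msize (g \mPo h) <= msize (g \mPo h) * N)%N.
    by rewrite mulnC leq_mul2l (ltnW (ltn_ord j)) orbT.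
  move: (sD i) (msizeX_le (g \mPo h) j) jN; rewrite mulnDl /=.
  move: (msize (s i \mPo h)) (msize ((g \mPo h) ^+ j)) (msize (g \mPo h) * N)%N.
  by move: (j * _)%N (D * N)%N => x y a b c; lia.
Qed.

(** Counting: N ^ w.+1 independent polynomials would be pulled back into a
    space of dimension at most (D * N).+1 ^ w, which is smaller for N > D.+1 ^
    w. *)
Lemma chain_length_le (K : numFieldType) d w (h : d.-tuple {mpoly K[w]})
    (X : set (projective K d)) m (Z : nat -> set (projective K d)) :
  (forall p, X p -> forall v, v \in proj_line p -> v != 0 ->
     exists u : 'I_w -> K, forall i, v 0 i = (tnth h i).@[u]) ->
  irreducible_chain X m Z -> (m <= w)%N.
Proof.
move=> Xh Zch; rewrite leqNgt; apply/negP => wm.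
have [D fam] := chain_family h Zch wm.
pose N := ((D.+1 ^ w).+1)%N.
have [I [s [cardI indep sD]]] := fam N.
have lt : ((D * N).+1 ^ w < #|I|)%N.
  rewrite cardI expnSr; apply: leq_ltn_trans (_ : _ <= (D.+1 * N) ^ w)%N _.
    have le : ((D * N).+1 <= D.+1 * N)%N by rewrite mulSn -add1n leq_add2r.
    have [w0|w0] := posnP w; last by rewrite leq_exp2r.
    by rewrite [in X in (X <= _)%N]w0 [in X in (_ <= X)%N]w0 !expn0.
  by rewrite expnMn mulnC ltn_pmul2l ?expn_gt0.
have [c [i ci] cs] := linear_dependency sD lt.
have := indep c; rewrite (_ : c i = 0) ?eqxx // in ci.
apply: indep => p Zp v vp v0.
have Xp : X p by have [/(_ w wm)[[Y _ ZY] _] _] := Zch; move: Zp; rewrite ZY => -[].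
have [u uv] := Xh p Xp v vp v0.
have ps0 : (\sum_i c i *: s i) \mPo h = 0.
  by rewrite -cs raddf_sum; apply: eq_bigr => i' _; rewrite /= comp_mpolyZ.
by rewrite (meval_eq _ uv) -comp_mpoly_meval ps0 meval0.
Qed.

(** * Linear subspaces and their images under inversion *)

Definition subspace_points (K : fieldType) d (U : 'M[K]_d) :
    set (projective K d) :=
  [set p | forall v, v \in proj_line p -> v != 0 -> (v <= U)%MS].

Definition reciprocal (K : fieldType) d (v : 'rV[K]_d) : 'rV[K]_d :=
  \row_i (v 0 i)^-1.

Definition nowhere_zero (K : fieldType) d (v : 'rV[K]_d) : Prop :=
  forall i, v 0 i != 0.

Lemma reciprocalK (K : fieldType) d : involutive (@reciprocal K d).
Proof. by move=> v; apply/rowP => i; rewrite !mxE invrK. Qed.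

Lemma reciprocalZ (K : fieldType) d c (v : 'rV[K]_d) :
  reciprocal (c *: v) = c^-1 *: reciprocal v.
Proof. by apply/rowP => i; rewrite !mxE invfM. Qed.

Lemma reciprocal_nowhere_zero (K : fieldType) d (v : 'rV[K]_d) :
  nowhere_zero v -> nowhere_zero (reciprocal v).
Proof. by move=> v0 i; rewrite mxE invr_eq0. Qed.

Lemma nowhere_zero_neq0 (K : fieldType) d (v w : 'rV[K]_d) :
  nowhere_zero v -> w != 0 -> v != 0.
Proof.
move=> v0 /rV0Pn[i _]; apply/rV0Pn; exists i; exact: v0.
Qed.

Lemma nowhere_zeroZ (K : fieldType) d c (v : 'rV[K]_d) :
  c != 0 -> nowhere_zero v -> nowhere_zero (c *: v).
Proof. by move=> c0 v0 i; rewrite mxE mulf_neq0. Qed.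

Lemma OT_generator_homog (K : fieldType) d (Lam : {set 'I_d}) (c : 'rV[K]_d) :
  OT_generator Lam c \is #|Lam|.-1.-homog.
Proof.
apply: rpred_sum => i iL; apply: rpredZ.
have -> : #|Lam|.-1 = (\sum_(j in Lam :\ i) 1)%N.
  by rewrite sum1_card (cardsD1 i Lam) iL.
apply: (big_rec2 (fun p k => p \is k.-homog)) => [|j k p _ pk].
  exact: dhomog1.
by apply: dhomogM => //; rewrite dhomogX /= mdeg1.
Qed.

Lemma OT_generator_eval (K : fieldType) d (Lam : {set 'I_d}) (c v : 'rV[K]_d) :
  nowhere_zero v ->
  (OT_generator Lam c).@[v 0] =
  (\prod_(i in Lam) v 0 i) * \sum_(i in Lam) c 0 i * reciprocal v 0 i.
Proof.
move=> v0; rewrite /OT_generator raddf_sum mulr_sumr; apply: eq_bigr => i iL /=.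
rewrite mevalZ mxE (big_setD1 i iL) /= rmorph_prod /=.
rewrite (eq_bigr (fun j => v 0 j)) => [|j _]; last exact: mevalXU.
by rewrite [RHS]mulrC -mulrA mulKf.
Qed.

Definition reciprocal_points (K : fieldType) d (U : 'M[K]_d) :
    set (projective K d) :=
  [set p | forall v, v \in proj_line p -> v != 0 ->
     nowhere_zero v /\ (reciprocal v <= U)%MS].

Lemma subspace_pointsP (K : fieldType) d (U : 'M[K]_d) p v :
  v \in proj_line p -> v != 0 -> subspace_points U p <-> (v <= U)%MS.
Proof.
move=> vp v0; split=> [/(_ v vp v0) //|vU w wp w0].
by have [c _ ->] := proj_line_scale vp v0 wp w0; apply: scalemx_sub.
Qed.

Lemma reciprocal_pointsP (K : fieldType) d (U : 'M[K]_d) p v :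
  v \in proj_line p -> v != 0 ->
  reciprocal_points U p <-> nowhere_zero v /\ (reciprocal v <= U)%MS.
Proof.
move=> vp v0; split=> [/(_ v vp v0) //|[vn vU] w wp w0].
have [c c0 ->] := proj_line_scale vp v0 wp w0; split.
  exact: nowhere_zeroZ.
by rewrite reciprocalZ; apply: scalemx_sub.
Qed.

(** The columns of the cokernel matrix are linear equations of U. *)
Lemma subspace_points_closed (K : fieldType) d (U : 'M[K]_d) :
  zariski_closed (subspace_points U).
Proof.
exists [set f | exists k, f = \sum_i cokermx U i k *: 'X_i].
have ev k (v : 'rV_d) : (\sum_i cokermx U i k *: 'X_i).@[v 0] = (v *m cokermx U) 0 k.
  rewrite raddf_sum mxE; apply: eq_bigr => i _.
  by rewrite /= mevalZ mevalXU mulrC.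
apply/seteqP; split=> p.
  move=> pU _ _ [k ->] _ v vp v0; have := pU v vp v0.
  by rewrite submxE ev => /eqP ->; rewrite mxE.
move=> pJ v vp v0; rewrite submxE; apply/eqP/rowP => k; rewrite [RHS]mxE -ev.
apply: (pJ 1%N _ _ _ v vp v0); first by exists k.
by apply: rpred_sum => i _; apply: rpredZ; rewrite dhomogX /= mdeg1.
Qed.

(** Clearing denominators in a linear equation in the 1 / v_i gives an equation
    of the shape of an Orlik-Terao generator on the full index set. *)
Lemma reciprocal_points_closed (K : fieldType) d (U W : 'M[K]_d) :
  (U <= W)%MS -> zariski_closed_in (reciprocal_points W) (reciprocal_points U).
Proof.
move=> UW.
pose f k := OT_generator [set: 'I_d] (\row_i cokermx U i k).
exists (proj_zeros (range f)); first by exists (range f).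
have ev k (v : 'rV_d) : nowhere_zero v ->
    (f k).@[v 0] = (\prod_i v 0 i) * (reciprocal v *m cokermx U) 0 k.
  move=> vn; rewrite OT_generator_eval //; congr (_ * _).
    by apply: eq_bigl => i; rewrite inE.
  rewrite [RHS]mxE; apply: eq_big => i; first by rewrite inE.
  by rewrite [X in X * _]mxE mulrC.
apply/seteqP; split=> p.
  move=> pU; split=> [v vp v0|_ _ [k _ <-] _ v vp v0].
    by have [vn vU] := pU v vp v0; split=> //; apply: submx_trans UW.
  have [vn] := pU v vp v0; rewrite submxE ev // => /eqP ->.
  by rewrite mxE mulr0.
move=> [pW pJ] v vp v0; have [vn _] := pW v vp v0; split=> //.
rewrite submxE; apply/eqP/rowP => k; rewrite [RHS]mxE; apply/eqP.
have := pJ _ (f k) _ (OT_generator_homog _ _) v vp v0; rewrite ev //.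
move=> /(_ (imageT _ _))/eqP; rewrite mulf_eq0 => /orP[|//].
by move=> /prodf_eq0[i _]; rewrite (negbTE (vn i)).
Qed.

(** * Irreducibility *)

(** If neither of two closed sets contains Z, some form of each is nonzero at a
    point of Z. On a curve through both points the two forms restrict to
    nonzero univariate polynomials, so a general point of the curve lies
    outside both sets. The polynomial e excludes the finitely many parameters
    where the curve leaves Z. *)
Lemma irreducible_of_curves (K : numFieldType) d (Z : set (projective K d)) :
  Z !=set0 ->
  (forall p q, Z p -> Z q ->
     exists (g : 'I_d -> {poly K}) (e : {poly K}) (a b : K),
       let gamma t := \row_i (g i).[t] in
       [/\ e != 0,
           forall t, e.[t] != 0 ->
             exists2 r, Z r & gamma t \in proj_line r /\ gamma t != 0,
           gamma a \in proj_line p /\ gamma a != 0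
         & gamma b \in proj_line q /\ gamma b != 0]) ->
  irreducible_set Z.
Proof.
move=> Zne Zcurve; split=> // _ _ [J ->] [J' ->] ZJJ'.
apply: contrapT => /not_orP[nJ nJ'].
have pick (J0 : set {mpoly K[d]}) : ~ (Z `<=` proj_zeros J0) ->
    exists p k f, [/\ Z p, J0 f, f \is k.-homog &
      forall v, v \in proj_line p -> v != 0 -> f.@[v 0] != 0].
  move=> /existsNP[p /not_implyP[Zp /existsNP[k /existsNP[f]]]].
  move=> /not_implyP[J0f /not_implyP[fk /existsNP[v /not_implyP[vp]]]].
  move=> /not_implyP[v0 /eqP fv]; exists p, k, f; split=> // w wp w0.
  apply: contraNneq fv => fw.
  by apply/eqP; apply: (homog_zero_rep fk wp w0 fw).
have [p [k [f [Zp Jf fk fp]]]] := pick _ nJ.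
have [q [l [h [Zq Jh hl hq]]]] := pick _ nJ'.
have [g [e [a [b [e0 gZ [ap a0] [bq b0]]]]]] := Zcurve p q Zp Zq.
have ev f' t : (along g f').[t] = f'.@[(\row_i (g i).[t]) 0].
  by rewrite horner_along; apply: meval_eq => i; rewrite mxE.
have f0 : along g f != 0.
  by apply: contraNneq (fp _ ap a0) => f0; rewrite -ev f0 horner0.
have h0 : along g h != 0.
  by apply: contraNneq (hq _ bq b0) => h0; rewrite -ev h0 horner0.
have /exists_nonroot[t _] : e * along g f * along g h != 0 by rewrite !mulf_neq0.
rewrite !hornerM !mulf_eq0 !negb_or !ev => /andP[/andP[/gZ[r Zr [tr t0]] ft] ht].
by case: (ZJJ' r Zr) => [/(_ _ _ Jf fk _ tr t0)|/(_ _ _ Jh hl _ tr t0)]/eqP;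
  rewrite ?(negbTE ft) ?(negbTE ht).
Qed.

Definition segment (K : fieldType) d (x y : 'rV[K]_d) (i : 'I_d) : {poly K} :=
  (x 0 i)%:P + (y 0 i - x 0 i) *: 'X.

Lemma horner_segment (K : fieldType) d (x y : 'rV[K]_d) t i :
  (segment x y i).[t] = (x + t *: (y - x)) 0 i.
Proof. by rewrite /segment !hornerE !mxE mulrC. Qed.

Lemma segment_sub (K : fieldType) d (x y : 'rV[K]_d) (U : 'M[K]_d) t :
  (x <= U)%MS -> (y <= U)%MS -> ((x + t *: (y - x))%R <= U)%MS.
Proof.
move=> xU yU; apply: addmx_sub => //; apply: scalemx_sub.
by apply: addmx_sub; rewrite ?eqmx_opp.
Qed.

Lemma subspace_points_irreducible (K : numFieldType) d (U : 'M[K]_d)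
    (w : 'rV[K]_d) :
  (w <= U)%MS -> w != 0 -> irreducible_set (subspace_points U).
Proof.
move=> wU w0; apply: irreducible_of_curves.
  by exists (point_of w0); apply/(subspace_pointsP U (mem_point_of w0) w0).
move=> p q pU qU.
have [x x0 px] := proj_line_rep p; have [y y0 qy] := proj_line_rep q.
have xp : x \in proj_line p by rewrite px memv_line.
have yq : y \in proj_line q by rewrite qy memv_line.
have /rV0Pn[i xi] := x0.
exists (segment x y), (segment x y i), 0, 1 => gamma.
have gE t : gamma t = x + t *: (y - x).
  by apply/rowP => j; rewrite mxE horner_segment.
rewrite !gE scale0r addr0 scale1r [x + _]addrC subrK; split=> //.
  apply: contraNneq xi => s0; have := horner_segment x y 0 i.
  by rewrite s0 horner0 scale0r addr0 => <-.
move=> t; rewrite horner_segment => nz.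
have gt0 : gamma t != 0 by apply/rV0Pn; exists i; rewrite gE.
exists (point_of gt0); last by rewrite mem_point_of.
apply/(subspace_pointsP U (mem_point_of gt0) gt0); rewrite gE.
by apply: segment_sub; [apply: pU|apply: qU].
Qed.

(** The polynomial form of coordinatewise inversion. *)
Definition cremona (A : comNzRingType) d (v : 'I_d -> A) (i : 'I_d) : A :=
  \prod_(j | j != i) v j.

Lemma cremona_reciprocal (K : fieldType) d (v : 'rV[K]_d) i :
  nowhere_zero v ->
  cremona (v 0) i = ((\prod_j v 0 j) *: reciprocal v) 0 i.
Proof.
by move=> v0; rewrite !mxE (bigD1 i) //= mulrC mulKf.
Qed.

Lemma reciprocal_points_irreducible (K : numFieldType) d (U : 'M[K]_d)
    (w : 'rV[K]_d) :
  (w <= U)%MS -> nowhere_zero w -> w != 0 ->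
  irreducible_set (reciprocal_points U).
Proof.
move=> wU wn w0; have rn := reciprocal_nowhere_zero wn.
have r0 := nowhere_zero_neq0 rn w0; apply: irreducible_of_curves.
  exists (point_of r0); apply/(reciprocal_pointsP U (mem_point_of r0) r0).
  by rewrite reciprocalK.
move=> p q pU qU.
have [x' x'0 px] := proj_line_rep p; have [y' y'0 qy] := proj_line_rep q.
have xp : x' \in proj_line p by rewrite px memv_line.
have yq : y' \in proj_line q by rewrite qy memv_line.
have [x'n xU] := pU _ xp x'0; have [y'n yU] := qU _ yq y'0.
set x := reciprocal x' in xU; set y := reciprocal y' in yU.
have xn : nowhere_zero x by apply: reciprocal_nowhere_zero.
have yn : nowhere_zero y by apply: reciprocal_nowhere_zero.
exists (cremona (segment x y)), (\prod_j segment x y j), 0, 1 => gamma.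
pose l t := x + t *: (y - x).
have hornerP t : (\prod_j segment x y j).[t] = \prod_j l t 0 j.
  by rewrite horner_prod; apply: eq_bigr => j _; rewrite horner_segment.
have gE t : nowhere_zero (l t) ->
    gamma t = (\prod_j l t 0 j) *: reciprocal (l t).
  move=> ln; apply/rowP => i; rewrite -cremona_reciprocal // mxE /cremona.
  by rewrite horner_prod; apply: eq_bigr => j _; rewrite horner_segment.
have g0 t : nowhere_zero (l t) -> gamma t != 0.
  move=> ln; rewrite gE // scaler_eq0 negb_or; apply/andP; split.
    by apply/prodf_neq0 => j _; apply: ln.
  exact: nowhere_zero_neq0 (reciprocal_nowhere_zero ln) w0.
have l0 : l 0 = x by rewrite /l scale0r addr0.
have l1 : l 1 = y by rewrite /l scale1r addrC subrK.
split.
- have : \prod_j l 0 0 j != 0 by rewrite l0; apply/prodf_neq0 => j _; apply: xn.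
  by apply: contraNneq => e0; rewrite -hornerP e0 horner0.
- move=> t; rewrite hornerP => /prodf_neq0 lt.
  have ln : nowhere_zero (l t) by move=> j; apply: lt.
  have gt0 := g0 t ln; exists (point_of gt0); last by rewrite mem_point_of.
  apply/(reciprocal_pointsP U (mem_point_of gt0) gt0); rewrite gE //; split.
    apply: nowhere_zeroZ; last exact: reciprocal_nowhere_zero.
    exact/prodf_neq0.
  by rewrite reciprocalZ reciprocalK scalemx_sub // segment_sub.
- have ln : nowhere_zero (l 0) by rewrite l0.
  by split; [rewrite gE // l0 reciprocalK memvZ|apply: g0].
- have ln : nowhere_zero (l 1) by rewrite l1.
  by split; [rewrite gE // l1 reciprocalK memvZ|apply: g0].
Qed.

(** * Chains from flags *)

(** If w lies in U, adding a suitable nonzero multiple of a row of V outside U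
    leaves U and keeps the coordinates nonzero. *)
Lemma nowhere_zero_outside (K : numFieldType) d (U V : 'M[K]_d)
    (w : 'rV[K]_d) :
  (w <= V)%MS -> nowhere_zero w -> ~~ (V <= U)%MS ->
  exists2 b, nowhere_zero b & (b <= V)%MS && ~~ (b <= U)%MS.
Proof.
move=> wV wn VU; have [wU|wU] := boolP (w <= U)%MS; last first.
  by exists w => //; rewrite wV.
have /row_subPn[i iU] := VU.
set r := row i V in iU.
have : \prod_j ((w 0 j)%:P + r 0 j *: 'X) != 0.
  apply/prodf_neq0 => j _; apply: contraNneq (wn j) => /(congr1 (fun p => p.[0])).
  by rewrite !hornerE => ->.
case/exists_nonroot => t t0; rewrite horner_prod => /prodf_neq0 wr.
exists (w + t *: r) => [j|].
  by have := wr j isT; rewrite !hornerE !mxE mulrC.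
rewrite addmx_sub ?scalemx_sub ?row_sub //=.
apply: contra iU => wrU; rewrite -[r](scalerK t0) scalemx_sub //.
by rewrite -[t *: r](addKr w) addmx_sub // eqmx_opp.
Qed.

Lemma exists_flag (K : fieldType) d (W : 'M[K]_d) (w : 'rV[K]_d) :
  (w <= W)%MS -> exists U : nat -> 'M[K]_d,
    (forall k, (w <= U k)%MS && (U k <= W)%MS) /\
    (forall k, (k.+1 < \rank W)%N -> (U k < U k.+1)%MS).
Proof.
move=> wW.
(* Add at each step the first row of W outside the space reached so far: the rank
   grows by at most one, so W is not exhausted before the last step. *)
pose next (V : 'M_d) :=
  if [pick i | ~~ (row i W <= V)%MS] is Some i then (V + row i W)%MS else V.
pose U k := iter k next <<w>>%MS.
have Usub k : (U k <= U k.+1)%MS.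
  by rewrite /U /= {2}/next; case: pickP => [i _|_] //; apply: addsmxSl.
have UW k : (U k <= W)%MS.
  elim: k => [|k IH]; first by rewrite genmxE.
  rewrite /U /= -/(U k) /next; case: pickP => [i _|_] //.
  by rewrite addsmx_sub IH row_sub.
have Urank k : (\rank (U k) <= k.+1)%N.
  elim: k => [|k IH]; first by rewrite genmxE rank_leq_row.
  rewrite /U /= -/(U k) /next; case: pickP => [i _|_]; last exact: leqW.
  apply: leq_trans (mxrank_adds_leqif _ _) _.
  by rewrite -[k.+2]addn1 leq_add // rank_leq_row.
exists U; split=> k.
  by rewrite UW andbT; elim: k => [|k IH]; [rewrite genmxE|apply: submx_trans IH _].
move=> kW; rewrite ltmxE Usub /=.
rewrite /U /= -/(U k) /next; case: pickP => [i iU|all_in].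
  by apply: contra iU; apply: submx_trans (addsmxSr _ _).
suff /mxrankS : (W <= U k)%MS by rewrite leqNgt (leq_ltn_trans (Urank k) kW).
by apply/row_subP => i; have := all_in i => /negbFE.
Qed.

Lemma subspace_points_chain (K : numFieldType) d (W : 'M[K]_d)
    (w : 'rV[K]_d) :
  (w <= W)%MS -> nowhere_zero w ->
  exists Z, irreducible_chain (subspace_points W) (\rank W) Z.
Proof.
move=> wW wn; have [U [wUW Ult]] := exists_flag wW.
exists (fun k => subspace_points (U k)); split=> k kW.
  have /andP[wU UW] := wUW k; split.
    exists (subspace_points (U k)); first exact: subspace_points_closed.
    apply/seteqP; split=> p; last by case.
    by move=> pU; split=> // v vp v0; apply: submx_trans (pU v vp v0) UW.
  apply: subspace_points_irreducible wU _.
  have /rowV0Pn[v _ v0] : W != 0 by rewrite -mxrank_eq0 -lt0n (leq_trans _ kW).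
  exact: nowhere_zero_neq0 wn v0.
have /andP[UU' U'U] := Ult k kW; have /andP[wU' _] := wUW k.+1.
split=> [p pU v vp v0|sub]; first exact: submx_trans (pU v vp v0) UU'.
have /row_subPn[i bU] := U'U; set b := row i _ in bU.
have b0 : b != 0 by apply: contraNneq bU => ->; apply: sub0mx.
move/negP: bU; apply; apply/(subspace_pointsP (U k) (mem_point_of b0) b0).
by apply: sub; apply/(subspace_pointsP _ (mem_point_of b0) b0); apply: row_sub.
Qed.

Lemma reciprocal_points_chain (K : numFieldType) d (W : 'M[K]_d)
    (w : 'rV[K]_d) :
  (w <= W)%MS -> nowhere_zero w ->
  exists Z, irreducible_chain (reciprocal_points W) (\rank W) Z.
Proof.
move=> wW wn; have [U [wUW Ult]] := exists_flag wW.
exists (fun k => reciprocal_points (U k)); split=> k kW.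
all: have /rowV0Pn[v _ v0] : W != 0 by rewrite -mxrank_eq0 -lt0n (leq_trans _ kW).
  have /andP[wU UW] := wUW k; split; first exact: reciprocal_points_closed.
  exact: reciprocal_points_irreducible wU wn (nowhere_zero_neq0 wn v0).
(* Only points of the torus can separate these two sets, hence the choice of b. *)
have /andP[UU' U'U] := Ult k kW; have /andP[wU' _] := wUW k.+1.
split=> [p pU u up u0|sub].
  by have [un uU] := pU u up u0; split=> //; apply: submx_trans uU UU'.
have [b bn /andP[bU' /negP]] := nowhere_zero_outside wU' wn U'U; apply.
have rn := reciprocal_nowhere_zero bn; have r0 := nowhere_zero_neq0 rn v0.
have rp := mem_point_of r0.
have : reciprocal_points (U k) (point_of r0).
  by apply: sub; apply/(reciprocal_pointsP _ rp r0); rewrite reciprocalK.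
by move=> /(reciprocal_pointsP _ rp r0)[_]; rewrite reciprocalK.
Qed.

(** * Krull dimensions *)

Lemma has_dim_uniq (K : fieldType) d (X : set (projective K d)) k l :
  has_dim X k -> has_dim X l -> k = l.
Proof.
move=> [m [-> [Z Zm] mmax]] [m' [-> [Z' Zm'] m'max]].
suff -> : m = m' by [].
by apply/eqP; rewrite eqn_leq (m'max _ _ Zm) (mmax _ _ Zm').
Qed.

Lemma has_dim_projective (K : numFieldType) d :
  has_dim [set: projective K d] (d%:Z - 1).
Proof.
exists d; split=> //.
  have one_nz : nowhere_zero (const_mx 1 : 'rV[K]_d).
    by move=> i; rewrite mxE oner_neq0.
  have [Z] := subspace_points_chain (submx1 _) one_nz; rewrite mxrank1.
  suff -> : subspace_points (1%:M : 'M[K]_d) = setT by exists Z.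
  by apply/seteqP; split=> // p _ v _ _; apply: submx1.
move=> m Z; apply: (chain_length_le (h := [tuple 'X_i | i < d])).
move=> p _ v _ _; exists (v 0) => i; rewrite tnth_mktuple.
by rewrite mevalXU.
Qed.

(** The upper bound comes from a parametrization by the coordinates u of a
    vector of W. The forms h i, of degree 2d - 1, give the inverse of that
    vector up to the factor (\prod_j l_j(u)) ^ 2, and rescaling u by a root of
    degree 2d - 1 removes it. *)
Lemma has_dim_reciprocal_points (K : numClosedFieldType) d (W : 'M[K]_d)
    (w : 'rV[K]_d) :
  (w <= W)%MS -> nowhere_zero w ->
  has_dim (reciprocal_points W) ((\rank W)%:Z - 1).
Proof.
move=> wW wn; exists (\rank W); split=> //.
  exact: reciprocal_points_chain wW wn.
pose B := row_base W.
pose l i : {mpoly K[\rank W]} := \sum_j B j i *: 'X_j.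
have lE i (u : 'rV_(\rank W)) : (l i).@[u 0] = (u *m B) 0 i.
  rewrite raddf_sum mxE; apply: eq_bigr => j _.
  by rewrite /= mevalZ mevalXU mulrC.
(* The additional factor \prod_j l j keeps the degree positive when d = 1, where
   the Cremona form is constant and could not be rescaled. *)
pose h i := (\prod_j l j) * cremona l i.
have hE i (u : 'rV_(\rank W)) : nowhere_zero (u *m B) ->
    (h i).@[u 0] = (\prod_j (u *m B) 0 j) ^+ 2 * reciprocal (u *m B) 0 i.
  move=> un; have := cremona_reciprocal i un; rewrite [RHS]mxE => cr.
  rewrite /h mevalM expr2 -mulrA -cr /cremona !rmorph_prod /=.
  by congr (_ * _); apply: eq_bigr => j _; rewrite lE.
move=> m Z; apply: (chain_length_le (h := [tuple h i | i < d])).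
move=> p pW v vp v0; have [vn] := pW v vp v0.
rewrite -(eq_row_base W) => /submxP[u uE].
have un : nowhere_zero (u *m B) by rewrite -uE; apply: reciprocal_nowhere_zero.
set a := (\prod_j reciprocal v 0 j) ^+ 2.
have a0 : a != 0 by rewrite expf_neq0 //; apply/prodf_neq0 => j _; rewrite uE; apply: un.
have d0 : (0 < d)%N by have /rV0Pn[i _] := v0; apply: leq_ltn_trans (ltn_ord i).
pose e := (d + d.-1)%N; have e0 : (0 < e)%N by rewrite addn_gt0 d0.
pose c := e.-root a^-1; have ce : c ^+ e = a^-1 by rewrite rootCK.
have c0 : c != 0.
  by apply: contraTneq (invr_neq0 a0) => c0; rewrite -ce c0 expr0n gtn_eqF // eqxx.
exists ((c *: u) 0) => i; rewrite tnth_mktuple hE -scalemxAl; last first.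
  exact: nowhere_zeroZ.
rewrite reciprocalZ -uE reciprocalK [in RHS]mxE.
under eq_bigr do rewrite mxE.
rewrite big_split /= prodr_const card_ord exprMn -[(\prod_(j < d) _) ^+ 2]/a.
have -> : c ^+ d ^+ 2 = c ^+ e * c.
  by rewrite -exprM muln2 -addnn /e -exprSr -addnS prednK.
rewrite ce; clearbody c; clearbody a.
by rewrite [a^-1 * c]mulrC -!mulrA mulKf // mulVKf.
Qed.

(** * Relations between the forms of an arrangement *)

Definition coef_mx (K : fieldType) n d (alpha : 'I_d -> {mpoly K[n]}) :
  'M[K]_(d, n) := \matrix_(i, j) (alpha i)@_(U_(j)).

Lemma linear_formE (K : fieldType) n (f : {mpoly K[n]}) :
  f \is 1.-homog -> f = \sum_j f@_(U_(j)) *: 'X_j.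
Proof.
move=> f1; apply/mpolyP => m; rewrite raddf_sum /=.
under eq_bigr do rewrite mcoeffZ mcoeffX.
have [/eqP/mdeg1P[i /eqP ->]|m1] := eqVneq (mdeg m) 1%N.
  rewrite (bigD1 i) //= eqxx mulr1 big1 ?addr0 // => j ji.
  by rewrite eq_mnm1 (negbTE ji) mulr0.
rewrite (dhomog_nemf_coeff f1 m1) big1 // => j _.
case: eqP => [mE|_]; last by rewrite mulr0.
by rewrite -mE mdeg1 eqxx in m1.
Qed.

Lemma arrangement_eval (K : fieldType) n d (alpha : 'I_d -> {mpoly K[n]}) :
  is_arrangement alpha -> forall (v : 'rV_n) i,
  (alpha i).@[v 0] = (v *m (coef_mx alpha)^T) 0 i.
Proof.
move=> arr v i; rewrite {1}(linear_formE (arr_linear arr i)) raddf_sum mxE.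
by apply: eq_bigr => j _; rewrite /= mevalZ mevalXU !mxE mulrC.
Qed.

Lemma is_relationP (K : fieldType) n d (alpha : 'I_d -> {mpoly K[n]}) c :
  is_arrangement alpha ->
  is_relation alpha c <-> c *m coef_mx alpha = 0.
Proof.
move=> arr; split=> [rel|cA].
  apply/rowP => j; rewrite !mxE.
  have /(congr1 (mcoeff U_(j))) := rel; rewrite raddf_sum mcoeff0 => sum0.
  rewrite -[RHS]sum0; apply: eq_bigr => i _.
  by rewrite /= mcoeffZ mxE.
rewrite /is_relation.
under eq_bigr => i _ do rewrite (linear_formE (arr_linear arr i)) scaler_sumr.
rewrite exchange_big big1 //= => j _; under eq_bigr do rewrite scalerA.
rewrite -scaler_suml; have /rowP/(_ j) := cA; rewrite !mxE => cAj.
rewrite (_ : \sum_i _ = 0) ?scale0r // -[RHS]cAj.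
by apply: eq_bigr => i _; rewrite mxE.
Qed.

Definition support_of (K : fieldType) d (c : 'rV[K]_d) : {set 'I_d} :=
  [set i | c 0 i != 0]%SET.

(** One term would make a form zero, and two terms would make two hyperplanes
    equal. *)
Lemma relation_support (K : fieldType) n d (alpha : 'I_d -> {mpoly K[n]}) c :
  is_arrangement alpha -> is_relation alpha c -> c != 0 ->
  (2 < #|support_of c|)%N.
Proof.
move=> arr rel /rV0Pn[i ci]; rewrite ltnNge; apply/negP => le2.
have iT : i \in support_of c by rewrite inE.
have : (#|support_of c :\ i| <= 1)%N by move: le2; rewrite (cardsD1 i) iT.
rewrite leq_eqVlt ltnS leqn0 cards_eq0 => /orP[/cards1P[j Tj]|/eqP T0].
  have : j \in support_of c :\ i by rewrite Tj inE.
  rewrite !inE => /andP[ji cj].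
  have sum2 : c 0 i *: alpha i + c 0 j *: alpha j = 0.
    rewrite -[RHS]rel (bigD1 i) //= (bigD1 j) //= big1 ?addr0 // => k.
    move=> /andP[ki kj]; apply/eqP; rewrite scaler_eq0; apply/orP; left.
    by apply: contraR kj => ck; rewrite -finset.in_set1 -Tj !inE ki.
  have /eqP : j = i; last by rewrite (negbTE ji).
  apply: (arr_distinct arr); apply/seteqP; split=> v /= av.
    have /(congr1 (fun f => f.@[v 0])) := sum2.
    rewrite mevalD !mevalZ av mulr0 addr0 meval0 => /eqP.
    by rewrite mulf_eq0 (negbTE ci) => /eqP.
  have /(congr1 (fun f => f.@[v 0])) := sum2.
  rewrite mevalD !mevalZ av mulr0 add0r meval0 => /eqP.
  by rewrite mulf_eq0 (negbTE cj) => /eqP.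
have : c 0 i *: alpha i = 0.
  rewrite -[RHS]rel (bigD1 i) //= big1 ?addr0 // => k ki.
  apply/eqP; rewrite scaler_eq0; apply/orP; left.
  have : k \notin support_of c :\ i by rewrite T0 inE.
  by rewrite !inE ki /= negbK.
by move/eqP; rewrite scaler_eq0 (negbTE ci) (negbTE (arr_neq0 arr i)).
Qed.

(** * Quadrics of the Orlik-Terao ideal *)

Definition three_term_relation (K : fieldType) n d
    (alpha : 'I_d -> {mpoly K[n]}) (r : 'rV[K]_d) : Prop :=
  is_relation alpha r /\ #|support_of r| = 3%N.

Lemma mem_ideal_generated (A : comNzRingType) (S : set A) a :
  S a -> ideal_generated S a.
Proof.
move=> Sa; exists 1%N, (fun=> 1), (fun=> a); split=> //.
by rewrite big_ord1 mul1r.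
Qed.

Lemma three_term_quadric (K : fieldType) n d (alpha : 'I_d -> {mpoly K[n]}) r :
  three_term_relation alpha r ->
  let f := OT_generator (support_of r) r in
  f \is 2.-homog /\ quadratic_part (Orlik_Terao alpha) f.
Proof.
move=> [rel r3] f.
have f2 : f \is 2.-homog by have := OT_generator_homog (support_of r) r; rewrite r3.
split=> //; apply: (@mem_ideal_generated _ _ f); split=> //.
apply: (@mem_ideal_generated _ _ f).
exists (support_of r), r; split=> //.
  have /card_gt0P[i ir] : (0 < #|support_of r|)%N by rewrite r3.
  by exists i => //; rewrite inE in ir.
rewrite -[RHS]rel big_mkcond; apply: eq_bigr => i _.
by rewrite inE; case: eqP => //= ->; rewrite scale0r.
Qed.

(** A nontrivial dependency on at most three indices is a three-term relation,
    so its generator is a quadric that vanishes at v; all other generators have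
    degree at least three. *)
Lemma OT_generator_zero_or_big (K : fieldType) n d
    (alpha : 'I_d -> {mpoly K[n]}) (Lam : {set 'I_d}) (c v : 'rV[K]_d) :
  is_arrangement alpha -> nowhere_zero v ->
  (forall r, three_term_relation alpha r ->
     \sum_i r 0 i * reciprocal v 0 i = 0) ->
  (exists2 i, i \in Lam & c 0 i != 0) ->
  \sum_(i in Lam) c 0 i *: alpha i = 0 ->
  (OT_generator Lam c).@[v 0] = 0 \/ (2 < #|Lam|.-1)%N.
Proof.
move=> arr vn v3 [i iL ci] rel.
have [|L3] := ltnP 3 #|Lam|; first by case: #|Lam| => // l; right.
left; pose c' : 'rV_d := \row_j if j \in Lam then c 0 j else 0.
have c'0 : c' != 0 by apply/rV0Pn; exists i; rewrite mxE iL.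
have rel' : is_relation alpha c'.
  rewrite /is_relation -[RHS]rel [RHS]big_mkcond; apply: eq_bigr => j _.
  by rewrite mxE; case: ifP => // _; rewrite scale0r.
have sup : support_of c' \subset Lam.
  by apply/fintype.subsetP => j; rewrite inE mxE; case: ifP => //; rewrite eqxx.
have c'3 : three_term_relation alpha c'.
  split=> //; apply/eqP; rewrite eqn_leq (relation_support arr rel' c'0) andbT.
  exact: leq_trans (subset_leq_card sup) L3.
rewrite OT_generator_eval // (_ : \sum_(j in Lam) _ = 0) ?mulr0 //.
rewrite -[RHS](v3 _ c'3) big_mkcond; apply: eq_bigr => j _.
by rewrite [c' 0 j]mxE; case: ifP => //; rewrite mul0r.
Qed.

(** The coefficient of X^2 in the restriction of a quadric of the ideal to the
    line through v is the value at v. Generators of degree at least three do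
    not contribute to it, and the others vanish on the line. *)
Lemma quadratic_part_eval (K : fieldType) n d
    (alpha : 'I_d -> {mpoly K[n]}) (v : 'rV[K]_d) f :
  is_arrangement alpha -> nowhere_zero v ->
  (forall r, three_term_relation alpha r ->
     \sum_i r 0 i * reciprocal v 0 i = 0) ->
  quadratic_part (Orlik_Terao alpha) f -> f.@[v 0] = 0.
Proof.
move=> arr vn v3 [m [a [g [gI ->]]]]; rewrite raddf_sum big1 //= => j _.
have [[m' [b [h [hgen gE]]]] g2] := gI j; rewrite mevalM.
suff -> : (g j).@[v 0] = 0 by rewrite mulr0.
have /(congr1 (fun q : {poly K} => q`_2)) := along_ray_homog v g2.
rewrite coefZ coefXn eqxx mulr1 => <-.
rewrite gE raddf_sum coef_sum big1 //= => i _.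
have [Lam [c [cL rel ->]]] := hgen i.
rewrite rmorphM /= (along_ray_homog v (OT_generator_homog Lam c)) -scalerAr coefZ.
rewrite coefMXn.
have [->|->] := OT_generator_zero_or_big arr vn v3 cL rel; first by rewrite mul0r.
by rewrite mulr0.
Qed.

Lemma quadratic_zeros_in_torus (K : fieldType) n d k
    (alpha : 'I_d -> {mpoly K[n]}) (S : 'M[K]_(k, d)) :
  is_arrangement alpha ->
  (forall i, three_term_relation alpha (row i S)) ->
  (forall r, three_term_relation alpha r -> (r <= S)%MS) ->
  proj_zeros (quadratic_part (Orlik_Terao alpha)) `&` @proj_torus K d =
  reciprocal_points (kermx S^T).
Proof.
move=> arr Srel Sspan; apply/seteqP; split=> p.
  move=> [pI pT] v vp v0; have vn : nowhere_zero v by apply: pT.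
  split=> //; apply/sub_kermxP/rowP => i; rewrite !mxE.
  have [f2 fI] := three_term_quadric (Srel i).
  have := pI _ _ fI f2 v vp v0; rewrite OT_generator_eval // => /eqP.
  rewrite mulf_eq0 => /orP[/prodf_eq0[j _]|/eqP]; first by rewrite (negbTE (vn j)).
  rewrite big_mkcond => sum0; rewrite -[RHS]sum0; apply: eq_bigr => j _.
  by rewrite !mxE inE mxE mulrC; case: eqP => //= ->; rewrite mul0r.
move=> pW; split=> [l f fI _ v vp v0|v vp v0]; last by have [] := pW v vp v0.
have [vn /sub_kermxP vS] := pW v vp v0.
apply: quadratic_part_eval arr vn _ fI => r /Sspan/submxP[x ->].
have : reciprocal v *m (x *m S)^T = 0 by rewrite trmx_mul mulmxA vS mul0mx.
move/rowP/(_ 0); rewrite !mxE => sum0; rewrite -[RHS]sum0.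
by apply: eq_bigr => i _; rewrite mulrC; congr (_ * _); rewrite [RHS]mxE.
Qed.

(** * Linear algebra of 2-formality *)

(** Rows satisfying P are added as long as one lies outside the span; the rank
    bounds the number of steps. *)
Lemma spanning_matrix (K : fieldType) d (P : 'rV[K]_d -> Prop) :
  exists k (S : 'M[K]_(k, d)),
    (forall i, P (row i S)) /\ (forall v, P v -> (v <= S)%MS).
Proof.
suff grow m k (S : 'M[K]_(k, d)) : (d - \rank S <= m)%N ->
    (forall i, P (row i S)) ->
    exists k (S : 'M[K]_(k, d)),
      (forall i, P (row i S)) /\ (forall v, P v -> (v <= S)%MS).
  by apply: (grow d 0%N 0) => [|[]//]; apply: leq_subr.
elim: m k S => [|m IH] k S Sm SP.
  exists k, S; split=> // v _; apply: submx_full.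
  by rewrite /row_full eqn_leq rank_leq_col -subn_eq0 -leqn0.
have [all_in|/existsNP[v /not_implyP[Pv /negP vS]]] :=
  pselect (forall v, P v -> (v <= S)%MS); first by exists k, S.
apply: (IH (k + 1)%N (col_mx S v)) => [|i].
  have : (S < col_mx S v)%MS.
    by rewrite ltmxE -addsmxE addsmxSl; apply: contra vS;
      rewrite col_mx_sub => /andP[].
  rewrite ltmxErank => /andP[_ lt]; move: Sm; rewrite leq_subLR => Sm.
  by rewrite leq_subLR; apply: leq_trans Sm _; rewrite addnS -addSn leq_add2r.
rewrite -(splitK i); case: (split i) => j /=; first by rewrite rowKu.
rewrite rowKd (_ : row j v = v) //; apply/rowP => l.
by rewrite mxE ord1.
Qed.

(** On the moment curve (1, t, t^2, ...) each coordinate of the image is a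
    nonzero polynomial in t, and a general t avoids the roots of all of them.
    *)
Lemma nowhere_zero_image (K : numFieldType) n d (A : 'M[K]_(d, n)) :
  (forall i, row i A != 0) -> exists u : 'rV[K]_n, nowhere_zero (u *m A^T).
Proof.
move=> A0; pose f i := \poly_(j < n) (if insub j is Some j' then A i j' else 0).
have fE i (t : K) : (f i).[t] = ((\row_j t ^+ j) *m A^T) 0 i.
  rewrite horner_poly mxE; apply: eq_bigr => j _.
  by rewrite !mxE valK mulrC.
have : \prod_i f i != 0.
  apply/prodf_neq0 => i _; have /rV0Pn[j Aij] := A0 i.
  apply: contraNneq Aij => f0; have := congr1 (fun q : {poly K} => q`_j) f0.
  by rewrite coef_poly ltn_ord valK coef0 mxE => ->.
case/exists_nonroot => t _; rewrite horner_prod => /prodf_neq0 nz.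
by exists (\row_j t ^+ j) => i; rewrite -fE nz.
Qed.

Lemma two_formalP (K : fieldType) n d k (alpha : 'I_d -> {mpoly K[n]})
    (S : 'M[K]_(k, d)) :
  is_arrangement alpha ->
  (forall i, three_term_relation alpha (row i S)) ->
  (forall r, three_term_relation alpha r -> (r <= S)%MS) ->
  two_formal alpha <-> (kermx (coef_mx alpha) <= S)%MS.
Proof.
move=> arr Srel Sspan; split=> [formal|FS c rel].
  apply/row_subP => i.
  have /formal[s s3] : is_relation alpha (row i (kermx (coef_mx alpha))).
    by apply/(is_relationP _ arr)/sub_kermxP; apply: row_sub.
  move=> /(coord_span (X := in_tuple s)) ->; apply: summx_sub => j _.
  by apply: scalemx_sub; apply/Sspan/s3; apply: mem_nth.
exists [seq row i S | i <- enum 'I_k].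
  by move=> r /mapP[i _ ->]; apply: Srel.
have /submxP[x ->] : (c <= S)%MS.
  by apply: submx_trans FS; apply/sub_kermxP/(is_relationP _ arr).
rewrite mulmx_sum_row; apply: memv_suml => i _; apply/memvZ/memv_span.
by apply: map_f; rewrite mem_enum.
Qed.

Lemma essential_rank (K : fieldType) n d (alpha : 'I_d -> {mpoly K[n]}) :
  is_arrangement alpha -> essential alpha -> \rank (coef_mx alpha) = n.
Proof.
move=> arr ess; rewrite -mxrank_tr; apply/eqP; rewrite -[_ == _]/(row_free _).
rewrite -kermx_eq0; apply/rowV0P => v /sub_kermxP vA.
suff : (\bigcap_i hyperplane (alpha i)) v by rewrite ess.
by move=> i _; rewrite /hyperplane /= (arrangement_eval arr) vA mxE.
Qed.

(** * The equivalence *)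

(** Both sides say that the span of the three-term relations has the dimension
    d - n of the relation space. *)
Lemma two_formal_iff_codim (K : numClosedFieldType) n d
    (alpha : 'I_d -> {mpoly K[n]}) :
  is_arrangement alpha -> essential alpha ->
  two_formal alpha <->
  has_codim (proj_zeros (quadratic_part (Orlik_Terao alpha))
               `&` @proj_torus K d) (d%:Z - n%:Z).
Proof.
move=> arr ess; have [k [S [Srel Sspan]]] := spanning_matrix (three_term_relation alpha).
rewrite (two_formalP arr Srel Sspan) (quadratic_zeros_in_torus arr Srel Sspan).
set A := coef_mx alpha; have rA : \rank A = n := essential_rank arr ess.
have SA : S *m A = 0.
  apply/row_matrixP => i; rewrite row_mul row0.
  by apply/(is_relationP _ arr); case: (Srel i).
have SF : (S <= kermx A)%MS by apply/sub_kermxP.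
have Arow i : row i A != 0.
  apply: contraNneq (arr_neq0 arr i) => Ai0.
  rewrite (linear_formE (arr_linear arr i)) big1 // => j _.
  by move/rowP/(_ j): Ai0; rewrite !mxE => ->; rewrite scale0r.
have [u wn] := nowhere_zero_image Arow; set w := u *m A^T in wn.
have wW : (w <= kermx S^T)%MS.
  by apply/sub_kermxP; rewrite -mulmxA -trmx_mul SA trmx0 mulmx0.
have dimX := has_dim_reciprocal_points wW wn.
have dimP := has_dim_projective K d.
have Sd := rank_leq_col S; have nd : (n <= d)%N by rewrite -rA rank_leq_row.
have -> : (kermx A <= S)%MS = (\rank S == d - n)%N.
  have := mxrank_leqif_sup SF; rewrite mxrank_ker rA => -[_ <-]; by [].
move: dimX; rewrite mxrank_ker mxrank_tr => dimX.
split=> [/eqP rS|[a [b [aP bX]]]].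
  exists (d%:Z - 1), ((d - \rank S)%:Z - 1); split=> //; lia.
rewrite (has_dim_uniq aP dimP) (has_dim_uniq bX dimX) => e; lia.
Qed.

Theorem theorem2p3 (R : realType) (n d : nat) (alpha : 'I_d -> {mpoly R[i][n]})
    (Harr : is_arrangement alpha) (Hess : essential alpha) :
  two_formal alpha <->
  has_codim (proj_zeros (quadratic_part (Orlik_Terao alpha))
               `&` @proj_torus _ d)
            (d%:Z - n%:Z).
Proof.
exact: two_formal_iff_codim Harr Hess.
Qed.
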